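(* Let $t_1,t_2>0$. The approximation problem $\mathrm{APP}=\{\mathrm{APP}_s\}_{s\in\mathbb N}$ is $(t_1,t_2)$-WT for the parameters $\boldsymbol a,\boldsymbol b,\boldsymbol m$ and $\omega$ if and only if $t_1>1$ or $m_0=1$.
   Context: Notation: $\mathbb N=\{1,2,\dots\}$, $\mathbb N_0=\{0,1,2,\dots\}$. Setting. $H$ is an infinite-dimensional separable Hilbert space over $\mathbb R$ or $\mathbb C$ with orthonormal basis $\{e_k\}_{k\in\mathbb N_0}$; $\omega\in(0,1)$; $\boldsymbol m=\{m_k\}_{k\in\mathbb N_0}$ is a bounded sequence of positive integers; $r_0=0$ and $r_k=m_0+\cdots+m_{k-1}$ for $k\ge1$. For $n\in\mathbb N_0$ let $k(n)$ be the unique $k\in\mathbb N_0$ with $r_k\le n\le r_{k+1}-1$. For $a,b>0$ let $$H_{a,b}=\Big\{f\in H:\ \|f\|_{H_{a,b}}:=\Big(\sum_{k=0}^\infty\omega^{-ak^b}\sum_{j=r_k}^{r_{k+1}-1}|\langle f,e_j\rangle_H|^2\Big)^{1/2}<\infty\Big\}.$$ The sequences $\boldsymbol a=\{a_j\}_{j\in\mathbb N}$, $\boldsymbol b=\{b_j\}_{j\in\mathbb N}$ consist of positive reals with $0<a_1\le a_2\le\cdots$ and $\inf_jb_j>0$. Let $H_s=H\otimes\cdots\otimes H$ ($s$-fold Hilbert tensor product) with orthonormal basis $e_{\boldsymbol n}=e_{n_1}\otimes\cdots\otimes e_{n_s}$, $\boldsymbol n\in\mathbb N_0^s$, and $H_{s,\boldsymbol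 a,\boldsymbol b}=H_{a_1,b_1}\otimes\cdots\otimes H_{a_s,b_s}$; equivalently, $H_{s,\boldsymbol a,\boldsymbol b}$ is the set of $f\in H_s$ with $\|f\|_{H_{s,\boldsymbol a,\boldsymbol b}}^2=\sum_{\boldsymbol n\in\mathbb N_0^s}\omega^{-\sum_{j=1}^sa_j[k(n_j)]^{b_j}}|\langle f,e_{\boldsymbol n}\rangle_{H_s}|^2<\infty$. The operator $\mathrm{APP}_s:H_{s,\boldsymbol a,\boldsymbol b}\to H_s$ is the embedding $\mathrm{APP}_sf=f$. Information complexity. For $n\in\mathbb N_0$, $e(n,\mathrm{APP}_s)=\inf_{A_n}\sup_{\|f\|_{H_{s,\boldsymbol a,\boldsymbol b}}\le1}\|f-A_nf\|_{H_s}$, the infimum being over all algorithms $A_nf=\sum_{j=1}^nL_j(f)g_j$ with continuous linear functionals $L_j$ on $H_{s,\boldsymbol a,\boldsymbol b}$ and $g_j\in H_s$ ($A_0=0$). For $\varepsilon>0$, $n(\varepsilon,\mathrm{APP}_s)=\min\{n\in\mathbb N_0:\ e(n,\mathrm{APP}_s)\le\varepsilon\}$. $(t_1,t_2)$-WT ($(t_1,t_2)$-weak tractability) means $$\lim_{s+\varepsilon^{-1}\to\infty}\frac{\log n(\varepsilon,\mathrm{APP}_s)}{s^{t_1}+\varepsilon^{-t_2}}=0,$$ the limit being over $s\in\mathbb N$, $\varepsilon\in(0,1)$. *)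

(* Defs.v *)
From HB Require Import structures.
From mathcomp Require Import all_boot all_order all_algebra.
From mathcomp Require Import all_classical all_reals all_analysis.
From mathcomp Require Import complex.
Set Implicit Arguments.
Unset Strict Implicit.
Unset Printing Implicit Defensive.
Import Order.TTheory GRing.Theory Num.Theory.
Import numFieldNormedType.Exports.
Local Open Scope classical_set_scope.
Local Open Scope ring_scope.

(** * Scalars: either the reals or the complex numbers *)

Inductive scalars := RealScalars | ComplexScalars.

Definition scalarField (R : realType) (k : scalars) : numFieldType :=
  match k with RealScalars => R | ComplexScalars => R[i] end.

Definition sconj (R : realType) (k : scalars) : scalarField R k -> scalarField R k :=
  match k with RealScalars => fun x => x | ComplexScalars => @Num.conj R[i] end.

Definition sre (R : realType) (k : scalars) : scalarField R k -> R :=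
  match k with RealScalars => fun x => x | ComplexScalars => @complex.Re R end.

(* Norms and absolute values live in [scalarField R k]; [norm] is the same number,
   as an element of [R]. *)
Definition norm (R : realType) (k : scalars)
    (V : normedZmodType (scalarField R k)) (x : V) : R := sre `|x|.

(** * Hilbert spaces, orthonormal bases and tensor powers *)

Record hilbertSpace (R : realType) (k : scalars) := HilbertSpace {
  hspace :> completeNormedModType (scalarField R k);
  (* linear in the first argument *)
  hdot : {dot hspace for @sconj R k};
  hdot_norm : forall x : hspace, `|x| ^+ 2 = hdot x x
}.
Arguments hdot {R k h}.

Section Hilbert.
Context {R : realType} {k : scalars}.
Implicit Types H V : hilbertSpace R k.

Definition lin_span V (I : Type) (u : I -> V) : set V :=
  [set v | exists (n : nat) (c : 'I_n -> scalarField R k) (i : 'I_n -> I),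
     v = \sum_(j < n) c j *: u (i j)].

Definition orthonormal_basis H (e : nat -> H) :=
  (forall i j, hdot (e i) (e j) = (i == j)%:R) /\ closure (lin_span e) = setT.

(* [T x] stands for the elementary tensor x_1 (x) ... (x) x_s. *)
Record hilbert_tensor_power H (s : nat) V (T : ('I_s -> H) -> V) : Prop := {
  tensor_linear : forall (x : 'I_s -> H) (i : 'I_s) c (u v : H),
    T (dfwith x i (c *: u + v)) = c *: T (dfwith x i u) + T (dfwith x i v);
  tensor_dot : forall x y : 'I_s -> H,
    hdot (T x) (T y) = \prod_(i < s) hdot (x i) (y i);
  tensor_total : closure (lin_span T) = setT
}.

End Hilbert.

(** * The weighted spaces *)

Definition partial_mult (m : nat -> nat) (k : nat) : nat := (\sum_(i < k) m i)%N.

Definition block (m : nat -> nat) (n : nat) : nat :=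
  xget 0%N [set k | (partial_mult m k <= n < partial_mult m k.+1)%N].

Section Weighted.
Context {R : realType} {k : scalars}.
(* [a i] and [b i] are the (i+1)-st weights a_(i+1) and b_(i+1). *)
Variables (omega : R) (m : nat -> nat) (a b : nat -> R).

Definition weight (s : nat) (n : {ffun 'I_s -> nat}) : R :=
  omega `^ (- \sum_(j < s) a j * (block m (n j))%:R `^ b j).

Variables (H : hilbertSpace R k) (e : nat -> H).
Variables (s : nat) (V : hilbertSpace R k) (T : ('I_s -> H) -> V).

Definition tensor_basis (n : {ffun 'I_s -> nat}) : V := T (fun j => e (n j)).

Definition wnorm_sq (f : V) : \bar R :=
  \esum_(n in [set: {ffun 'I_s -> nat}])
    (weight n * norm (hdot f (tensor_basis n)) ^+ 2)%:E.

Definition wspace : set V := [set f | (wnorm_sq f < +oo)%E].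

Definition wnorm (f : V) : R := Num.sqrt (fine (wnorm_sq f)).

(** * Algorithms, errors and information complexity *)

(* A functional on [wspace] is represented by a function on [V], whose values
   outside [wspace] are irrelevant; continuity is for the norm [wnorm]. *)
Record continuous_functional (L : V -> scalarField R k) : Prop := {
  functional_linear : forall c (f g : V), wspace f -> wspace g ->
    L (c *: f + g) = c * L f + L g;
  functional_continuous : forall f : V, wspace f ->
    forall eps : R, 0 < eps -> exists2 delta : R, 0 < delta &
      forall g : V, wspace g -> wnorm (g - f) < delta -> norm (L g - L f) < eps
}.

Definition algorithm (n : nat) : set (V -> V) :=
  [set A | exists (L : 'I_n -> V -> scalarField R k) (g : 'I_n -> V),
     (forall j, continuous_functional (L j)) /\
     A = (fun f => \sum_(j < n) L j f *: g j)].

Definition worst_case_error (A : V -> V) : \bar R :=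
  ereal_sup [set (norm (f - A f))%:E | f in [set f | wspace f /\ wnorm f <= 1]].

Definition minimal_error (n : nat) : \bar R :=
  ereal_inf [set worst_case_error A | A in algorithm n].

(* An infimum of naturals is attained, so this is the least such n;
   it is +oo if there is none. *)
Definition info_complexity (eps : R) : \bar R :=
  ereal_inf [set (n%:R : R)%:E | n in [set n | (minimal_error n <= eps%:E)%E]].

End Weighted.

(** * Weak tractability *)

(* [N s eps] is the information complexity. *)
Definition weakly_tractable (R : realType) (t1 t2 : R)
    (N : nat -> R -> \bar R) : Prop :=
  forall delta : R, 0 < delta -> exists M : R,
    forall (s : nat) (eps : R), (0 < s)%N -> 0 < eps < 1 ->
      M <= s%:R + eps^-1 ->
      (`| lne (N s eps) * ((s%:R `^ t1 + eps `^ (- t2))^-1)%:E | < delta%:E)%E.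

(* Main.v *)
Require Import Defs.
From HB Require Import structures.
From mathcomp Require Import all_boot all_order all_algebra.
From mathcomp Require Import all_classical all_reals all_analysis.
From mathcomp Require Import complex ring lra.
Set Implicit Arguments.
Unset Strict Implicit.
Unset Printing Implicit Defensive.
Import Order.TTheory GRing.Theory Num.Theory.
Import numFieldNormedType.Exports.
Local Open Scope classical_set_scope.
Local Open Scope ring_scope.

(** The [m 0 ^ s] basis tensors with all indices below [m 0] have weight 1, so
fewer than [m 0 ^ s] functionals vanish simultaneously on a unit vector of their
span, and the information complexity is at least [m 0 ^ s]; if [m 0 >= 2], its
logarithm grows linearly in [s], which excludes [t1 <= 1].

Conversely, projecting onto the basis tensors of weight below [eps ^- 2] has error
at most [eps].  With [x] proportional to [ln (1 / eps)], such a multi-index has at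
most [x] entries outside the first block, each bounded by a power of [x], so there
are at most [m 0 ^ s * (s * Q) ^ x] of them with [ln Q] at most affine in [x].  In
terms of [D = s ^ t1 + eps ^ - t2] the logarithm of this count is at most
[s * ln (m 0) + C * (1 + ln D) ^ 2], which is [o(D)] if [t1 > 1] or [m 0 = 1]. *)

(** * Embedding of the reals into the scalar field *)

Section Scalars.
Context {R : realType} (k : scalars).
Local Notation K := (scalarField R k).

(** Real norms are compared by pushing them into the scalar field, where [|x|] lives; the map is
    injective and reflects the order. *)
Definition sinj : R -> K :=
  match k return R -> scalarField R k with
  | RealScalars => fun x => x
  | ComplexScalars => real_complex R
  end.

Lemma sinj_is_zmod_morphism : zmod_morphism sinj.
Proof. by rewrite /sinj; case: k => //= x y; rewrite rmorphB. Qed.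

Lemma sinj_is_monoid_morphism : monoid_morphism sinj.
Proof.
by rewrite /sinj; case: k => /=; split=> // x y; rewrite ?rmorphM.
Qed.

HB.instance Definition _ := GRing.isZmodMorphism.Build R K sinj
  sinj_is_zmod_morphism.
HB.instance Definition _ := GRing.isMonoidMorphism.Build R K sinj
  sinj_is_monoid_morphism.

Lemma ler_sinj x y : (sinj x <= sinj y) = (x <= y).
Proof. by rewrite /sinj; case: k => //=; rewrite lecR. Qed.

Lemma sinj_inj : injective sinj.
Proof. by move=> x y xy; apply/eqP; rewrite eq_le -!ler_sinj xy lexx. Qed.

Lemma ltr_sinj x y : (sinj x < sinj y) = (x < y).
Proof. by rewrite !lt_neqAle ler_sinj (inj_eq sinj_inj). Qed.

Lemma sinj_sre (x : K) : 0 <= x -> sinj (sre x) = x.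
Proof. by rewrite /sre /sinj; case: k x => //= x /ger0_real /RRe_real. Qed.

Lemma sconj0 : sconj (0 : K) = 0.
Proof. by rewrite /sconj; case: k => //=; rewrite rmorph0. Qed.

End Scalars.

(** * Real-valued norms and closures *)

Section Norm.
Context {R : realType} {k : scalars}.
Local Notation K := (scalarField R k).

Lemma sinj_norm (V : normedZmodType K) (x : V) : sinj k (norm x) = `|x|.
Proof. by rewrite sinj_sre. Qed.

Section NormedZmod.
Variable V : normedZmodType K.
Implicit Types x y : V.

Lemma norm_ge0 x : 0 <= norm x.
Proof. by rewrite -(ler_sinj k) rmorph0 sinj_norm. Qed.

Lemma norm0 : norm (0 : V) = 0.
Proof. by apply: (@sinj_inj _ k); rewrite sinj_norm normr0 rmorph0. Qed.

Lemma norm_eq0 x : (norm x == 0) = (x == 0).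
Proof. by rewrite -(inj_eq (@sinj_inj _ k)) sinj_norm rmorph0 normr_eq0. Qed.

Lemma normD x y : norm (x + y) <= norm x + norm y.
Proof. by rewrite -(ler_sinj k) rmorphD /= !sinj_norm; exact: ler_normD. Qed.

End NormedZmod.

Lemma normM (x y : K) : norm (x * y) = norm x * norm y.
Proof. by apply: (@sinj_inj _ k); rewrite rmorphM /= !sinj_norm normrM. Qed.

Lemma normZ (V : normedModType K) (c : K) (x : V) :
  norm (c *: x) = norm c * norm x.
Proof. by apply: (@sinj_inj _ k); rewrite rmorphM /= !sinj_norm normrZ. Qed.

(** Every positive scalar is real, even in the complex case, so real radii suffice to describe
    neighbourhoods. *)
Lemma closure_norm (V : normedModType K) (A : set V) (x : V) :
  closure A x <-> forall eps : R, 0 < eps -> exists2 y, A y & norm (x - y) < eps.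
Proof.
split=> [cAx eps eps0|Ax B].
  have e0 : 0 < sinj k eps by rewrite -(rmorph0 (sinj k)) ltr_sinj.
  have [y [Ay]] := cAx _ (nbhsx_ballx x (PosNum e0)%:num [gt0 of (PosNum e0)%:num]).
  by rewrite -ball_normE /= => xy; exists y; rewrite // -(ltr_sinj k) sinj_norm.
move=> /nbhs_ballP[d /= d0 dB].
have dE := sinj_sre (ltW d0).
have [|y Ay xy] := Ax (sre d); first by rewrite -(ltr_sinj k) dE rmorph0.
exists y; split=> //; apply: dB; rewrite -ball_normE /=.
by rewrite -dE -sinj_norm ltr_sinj.
Qed.

End Norm.

(** * Linear spans and their closures *)

Section Spans.
Context {R : realType} {k : scalars} {V : hilbertSpace R k}.
Local Notation K := (scalarField R k).

Section Family.
Variables (I : Type) (u : I -> V).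

Lemma lin_span_gen i : lin_span u (u i).
Proof.
by exists 1%N, (fun=> 1), (fun=> i); rewrite big_ord1 scale1r.
Qed.

Lemma lin_spanP c x y : lin_span u x -> lin_span u y -> lin_span u (c *: x + y).
Proof.
move=> [n [p [i ->]]] [n' [p' [i' ->]]].
exists (n + n')%N.
exists (fun j : 'I_(n + n') => match fintype.split j with inl j => c * p j | inr j => p' j end).
exists (fun j : 'I_(n + n') => match fintype.split j with inl j => i j | inr j => i' j end).
rewrite big_split_ord /= scaler_sumr; congr (_ + _); apply: eq_bigr => j _.
  case: split_ordP => j' /eqP; rewrite ?eq_lshift ?eq_lrshift // => /eqP <-.
  by rewrite scalerA.
by case: split_ordP => j' /eqP; rewrite ?eq_rshift ?eq_rlshift // => /eqP <-.
Qed.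

Lemma lin_span0 : lin_span u 0.
Proof.
by exists 0%N, (fun=> 0), (fun j : 'I_0 => False_rect I (notF (ltn_ord j))); rewrite big_ord0.
Qed.

Lemma closure_lin_spanP c x y : closure (lin_span u) x -> closure (lin_span u) y ->
  closure (lin_span u) (c *: x + y).
Proof.
move=> /closure_norm cx /closure_norm cy; apply/closure_norm => eps eps0.
(* Adding 1 keeps the divisor positive when [c = 0]. *)
have c0 : 0 < norm c + 1 by rewrite ltr_wpDl ?norm_ge0.
have [|x' x'u xx'] := cx (eps / 2 / (norm c + 1)).
  by rewrite divr_gt0 ?divr_gt0.
have [|y' y'u yy'] := cy (eps / 2); first by rewrite divr_gt0.
exists (c *: x' + y'); first exact: lin_spanP.
rewrite opprD addrACA -scalerBr (le_lt_trans (normD _ _))// [ltRHS]splitr.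
rewrite ler_ltD// normZ (@le_trans _ _ ((norm c + 1) * norm (x - x')))//.
  by rewrite ler_wpM2r ?norm_ge0// lerDl.
by rewrite mulrC -ler_pdivlMr// ltW.
Qed.

Lemma closure_lin_span_sum n (c : 'I_n -> K) (x : 'I_n -> V) :
  (forall j, closure (lin_span u) (x j)) ->
  closure (lin_span u) (\sum_(j < n) c j *: x j).
Proof.
move=> xu; elim/big_rec: _ => [|j y _]; last exact: closure_lin_spanP.
exact/subset_closure/lin_span0.
Qed.

End Family.
End Spans.

(** * Orthonormal families: projections, Bessel and Parseval *)

Section InnerProduct.
Context {R : realType} {k : scalars} {V : hilbertSpace R k}.
Local Notation K := (scalarField R k).
Implicit Types f g : V.

Lemma sqr_norm f : sinj k (norm f ^+ 2) = hdot f f.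
Proof. by rewrite rmorphXn /= sinj_norm hdot_norm. Qed.

Lemma hdotC f g : hdot f g = sconj (hdot g f).
Proof. by rewrite (@hermitian_subproof _ _ _ _ hdot f g) expr0 mul1r. Qed.

Lemma hdotC0 f g : hdot f g = 0 -> hdot g f = 0.
Proof. by move=> fg; rewrite hdotC fg sconj0. Qed.

Lemma hdot_sumZl (I : Type) (s : seq I) (c : I -> K) (E : I -> V) g :
  hdot (\sum_(i <- s) c i *: E i) g = \sum_(i <- s) c i * hdot (E i) g.
Proof.
by rewrite linear_sumlz; apply: eq_bigr => i _; rewrite linearZl_LR.
Qed.

Lemma hdotPl c f g x : hdot (c *: f + g) x = c * hdot f x + hdot g x.
Proof. by rewrite linearDl linearZl_LR. Qed.

Lemma pythagoras f g : hdot f g = 0 ->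
  norm (f + g) ^+ 2 = norm f ^+ 2 + norm g ^+ 2.
Proof.
move=> fg; apply: (@sinj_inj _ k); rewrite rmorphD /= !sqr_norm.
by rewrite linearDl /= !linearDr /= fg (hdotC0 fg) addr0 add0r.
Qed.

Section Orthonormal.
Context {I : eqType} (E : I -> V).
Hypothesis orthoE : forall i j, hdot (E i) (E j) = (i == j)%:R.

Definition oproj (s : seq I) f := \sum_(i <- s) hdot f (E i) *: E i.

Lemma norm_orthonormal i : norm (E i) = 1.
Proof.
apply/eqP; rewrite -(@eqrXn2 _ 2) ?norm_ge0//; apply/eqP.
by apply: (@sinj_inj _ k); rewrite sqr_norm orthoE eqxx expr1n (rmorph1 (sinj k)).
Qed.

Lemma hdot_sum_orthonormal (s : seq I) (c : I -> K) i : uniq s ->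
  hdot (\sum_(j <- s) c j *: E j) (E i) = if i \in s then c i else 0.
Proof.
move=> us; rewrite hdot_sumZl; case: ifPn => si.
  rewrite (bigD1_seq i)//= orthoE eqxx mulr1 big1 ?addr0// => j ji.
  by rewrite orthoE (negPf ji) mulr0.
rewrite big1_seq// => j /= sj; rewrite orthoE.
by case: eqP => [ji|]; rewrite ?mulr0//; rewrite -ji sj in si.
Qed.

(** Induction on [s]: the component along a further basis vector is orthogonal to the new residual,
    so Pythagoras splits its square off. *)
Lemma bessel_eq (s : seq I) f : uniq s ->
  norm f ^+ 2 = norm (f - oproj s f) ^+ 2 + \sum_(i <- s) norm (hdot f (E i)) ^+ 2.
Proof.
elim: s => [|i s IH] /=; first by rewrite /oproj !big_nil subr0 addr0.
move=> /andP[si us]; rewrite IH// big_cons addrA; congr (_ + _).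
have fi : hdot (f - oproj s f) (E i) = hdot f (E i).
  by rewrite linearBl /= hdot_sum_orthonormal// (negPf si) subr0.
have -> : f - oproj s f = f - oproj (i :: s) f + hdot f (E i) *: E i.
  by rewrite /oproj big_cons opprD addrA addrAC subrK.
rewrite pythagoras; last first.
  apply: hdotC0; rewrite linearZl_LR /= [hdot (E i) _]hdotC0 ?mulr0// /oproj big_cons opprD.
  rewrite addrA addrAC -/(oproj s f) linearBl /= fi linearZl_LR /= orthoE eqxx.
  by rewrite mulr1 subrr.
by rewrite normZ norm_orthonormal mulr1.
Qed.

Lemma bessel (s : seq I) f : uniq s ->
  \sum_(i <- s) norm (hdot f (E i)) ^+ 2 <= norm f ^+ 2.
Proof. by move=> us; rewrite (bessel_eq f us) lerDr sqr_ge0. Qed.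

(** The indices [i j] may repeat, so coefficients are collected by exchanging the two sums; each [j]
    then meets its index in [s] exactly once. *)
Lemma oproj_id (s : seq I) n (c : 'I_n -> K) (i : 'I_n -> I) : uniq s ->
  (forall j, i j \in s) ->
  oproj s (\sum_(j < n) c j *: E (i j)) = \sum_(j < n) c j *: E (i j).
Proof.
move=> us si; rewrite /oproj; under eq_bigr => x _.
  rewrite hdot_sumZl scaler_suml; over.
rewrite exchange_big /=; apply: eq_bigr => j _.
rewrite (bigD1_seq (i j))//= orthoE eqxx mulr1 big1 ?addr0// => x xi.
by rewrite orthoE eq_sym (negPf xi) mulr0 scale0r.
Qed.

(** Since [p] is fixed by the projection, [f] and [f - p] have the same residual, and a residual has
    norm at most that of the vector itself. *)
Lemma oproj_best (s : seq I) f p : uniq s -> oproj s p = p ->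
  norm (f - oproj s f) <= norm (f - p).
Proof.
move=> us sp.
have -> : f - oproj s f = (f - p) - oproj s (f - p).
  suff -> : oproj s (f - p) = oproj s f - p by rewrite opprB addrA subrK.
  rewrite -[X in _ = _ - X]sp /oproj -sumrB; apply: eq_bigr => i _.
  by rewrite linearBl scalerBl.
rewrite -(@ler_pXn2r _ 2) ?nnegrE ?norm_ge0// (bessel_eq (f - p) us) lerDl.
by apply: sumr_ge0 => i _; rewrite sqr_ge0.
Qed.

(** A finite combination close to [f] involves finitely many indices; projecting onto these is at
    least as good, so Bessel's identity leaves a squared residual of at most [eps]. *)
Lemma parseval_le f (B : R) : closure (lin_span E) = setT ->
  (forall s, uniq s -> \sum_(i <- s) norm (hdot f (E i)) ^+ 2 <= B) ->
  norm f ^+ 2 <= B.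
Proof.
move=> totalE fB; apply/ler_addgt0Pr => eps eps0.
have : closure (lin_span E) f by rewrite totalE.
move=> /closure_norm /(_ (Num.sqrt eps)); rewrite sqrtr_gt0 => /(_ eps0)[_ [n [c [i ->]]]] fp.
pose s := undup [seq i j | j <- enum 'I_n].
have us : uniq s by exact: undup_uniq.
have si j : i j \in s by rewrite mem_undup map_f// mem_enum.
rewrite (bessel_eq f us) addrC lerD ?fB//.
rewrite -(sqr_sqrtr (ltW eps0)) ler_pXn2r ?nnegrE ?norm_ge0 ?sqrtr_ge0//.
exact: le_trans (oproj_best f us (oproj_id c us si)) (ltW fp).
Qed.

End Orthonormal.
End InnerProduct.

(** * Tensor bases *)

Section TensorBasis.
Context {R : realType} {k : scalars} (H : hilbertSpace R k) (e : nat -> H).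
Hypothesis he : orthonormal_basis e.
Context (s : nat) (V : hilbertSpace R k) (T : ('I_s -> H) -> V).
Hypothesis hT : hilbert_tensor_power T.
Local Notation K := (scalarField R k).

Lemma tensor_basis_ortho n n' :
  hdot (tensor_basis e T n) (tensor_basis e T n') = (n == n')%:R.
Proof.
rewrite /tensor_basis (tensor_dot hT).
under eq_bigr do rewrite he.1.
have [->|nn'] := eqVneq n n'; first by rewrite big1// => i _; rewrite eqxx.
have [i ni] : exists i, n i != n' i.
  apply/existsP; apply: contraR nn' => /existsPn h.
  by apply/eqP/ffunP => i; apply/eqP; move: (h i); rewrite negbK.
by rewrite (bigD1 i)//= (negPf ni) mul0r.
Qed.

Lemma norm_tensor x : norm (T x) = \prod_(i < s) norm (x i).
Proof.
have p0 : 0 <= \prod_(i < s) norm (x i) by apply: prodr_ge0 => i _; exact: norm_ge0.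
apply/eqP; rewrite -(@eqrXn2 _ 2) ?norm_ge0// -prodrXl; apply/eqP.
apply: (@sinj_inj _ k); rewrite rmorph_prod sqr_norm (tensor_dot hT).
by apply: eq_bigr => i _; rewrite /= sqr_norm.
Qed.

Section Slot.
Variables (x : 'I_s -> H) (i : 'I_s).

Lemma tensor_slot0 : T (dfwith x i 0) = 0.
Proof.
have := tensor_linear hT x i 1 0 0.
by move/eqP; rewrite scaler0 scale1r addr0 -subr_eq0 opprD addrA subrr add0r oppr_eq0 => /eqP.
Qed.

Lemma tensor_slot_sum n (c : 'I_n -> K) (u : 'I_n -> H) :
  T (dfwith x i (\sum_(j < n) c j *: u j)) = \sum_(j < n) c j *: T (dfwith x i (u j)).
Proof.
pose P v w := T (dfwith x i v) = w.
apply: (big_ind2 P) => [|v _ w _ <- <-|j _]; rewrite /P; first exact: tensor_slot0.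
  by rewrite -[in LHS](scale1r v) (tensor_linear hT) scale1r.
by have := tensor_linear hT x i (c j) (u j) 0; rewrite tensor_slot0 !addr0.
Qed.

Lemma tensor_slotB u v :
  T (dfwith x i u) - T (dfwith x i v) = T (dfwith x i (u - v)).
Proof.
rewrite addrC -scaleN1r -(tensor_linear hT); congr (T (dfwith x i _)).
by rewrite scaleN1r addrC.
Qed.

Lemma norm_tensor_slot u :
  norm (T (dfwith x i u)) = norm u * \prod_(j < s | j != i) norm (x j).
Proof.
rewrite norm_tensor (bigD1 i)//= dfwithin; congr (_ * _).
by apply: eq_bigr => j ji; rewrite dfwithout// eq_sym.
Qed.

End Slot.

(* Factors are replaced one at a time by combinations of basis vectors: [T] is
   linear and bounded in each slot, and [d] counts the slots still to be treated. *)
Lemma tensor_basis_total : closure (lin_span (tensor_basis e T)) = setT.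
Proof.
set W := closure _; have WW : closure W = W by apply/esym/closure_id; exact: closed_closure.
suff TW (d : nat) (x : 'I_s -> H) : (forall i : 'I_s, (d <= i)%N -> range e (x i)) -> W (T x).
  apply/seteqP; split=> // v _; have : closure (lin_span T) v by rewrite (tensor_total hT).
  rewrite -WW; apply: closureS => _ [n [c [x ->]]].
  by apply: closure_lin_span_sum => j; apply: (TW s) => i; rewrite leqNgt ltn_ord.
elim: d x => [|d IH] x xe.
  have ex i : {n | x i = e n} by apply: cid; have [n _ <-] := xe i isT; exists n.
  apply: subset_closure; rewrite (_ : T x = tensor_basis e T [ffun i => sval (ex i)]).
    exact: lin_span_gen.
  by congr T; apply/funext => i; rewrite ffunE; case: (ex i).
(* If [s <= d], no slot has index at least [d], so the hypothesis of the induction is vacuous. *)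
have [sd|ds] := leqP s d.
  by apply: IH => i /(leq_trans sd); rewrite leqNgt ltn_ord.
pose i := Ordinal ds.
have slotW v : lin_span e v -> W (T (dfwith x i v)).
  move=> [n [c [u ->]]]; rewrite tensor_slot_sum; apply: closure_lin_span_sum => j.
  apply: IH => l; case: dfwithP => [_|{}l il dl]; first by exists (u j).
  apply: xe; rewrite ltn_neqAle dl andbT.
  by apply: contraNneq il => dl'; apply/eqP/val_inj.
have : closure (lin_span e) (x i) by rewrite he.2.
move=> /closure_norm xi; rewrite -WW; apply/closure_norm => eps eps0.
(* Replacing slot [i] scales the error by [C]; the bound with [C + 1] also covers [C = 0]. *)
set C := \prod_(j < s | j != i) norm (x j).
have C0 : 0 <= C by apply: prodr_ge0 => j _; exact: norm_ge0.
have [|v ve xv] := xi (eps / (C + 1)); first by rewrite divr_gt0// ltr_wpDl.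
exists (T (dfwith x i v)); first exact: slotW.
have {1}-> : x = dfwith x i (x i).
  by apply/funext => j; case: dfwithP.
rewrite tensor_slotB norm_tensor_slot -/C.
rewrite (@le_lt_trans _ _ (norm (x i - v) * (C + 1)))//.
  by rewrite ler_wpM2l ?norm_ge0// lerDl.
by rewrite -ltr_pdivlMr// ltr_wpDl.
Qed.

End TensorBasis.

(** * Infinite sums of reals, controlled by finite duplicate-free lists *)

Section EsumReal.
Context {R : realType} {I : choiceType} (a : I -> R).

Lemma esum_le_seq (B : R) : (forall r, uniq r -> \sum_(i <- r) a i <= B) ->
  (\esum_(i in [set: I]) (a i)%:E <= B%:E)%E.
Proof.
move=> aB; apply: ge_ereal_sup => _ [X [finX _]] <-.
by rewrite fsbig_finite//= sumEFin lee_fin aB.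
Qed.

Lemma esum_ge_seq r : uniq r ->
  ((\sum_(i <- r) a i)%:E <= \esum_(i in [set: I]) (a i)%:E)%E.
Proof.
move=> ur; apply: esum_ge; exists [set` r]; first by split=> //; exact: finite_seq.
by rewrite -fsbig_seq// sumEFin.
Qed.

End EsumReal.

(** * Weighted spaces and minimal errors *)

Section Block.
Variables (m : nat -> nat) (m_gt0 : forall j, (0 < m j)%N).

Lemma partial_mult1 : partial_mult m 1 = m 0%N.
Proof. by rewrite /partial_mult big_ord1. Qed.

Lemma partial_multS i : partial_mult m i.+1 = (partial_mult m i + m i)%N.
Proof. by rewrite /partial_mult big_ord_recr. Qed.

Lemma partial_mult_homo : {homo partial_mult m : i j / (i <= j)%N}.
Proof.
apply: homo_leq => [//|x y z|i]; first exact: leq_trans.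
by rewrite partial_multS leq_addr.
Qed.

Lemma leq_partial_mult i : (i <= partial_mult m i)%N.
Proof.
elim: i => // i IH; rewrite partial_multS -addn1; exact: leq_add.
Qed.

Lemma blockP n : (partial_mult m (block m n) <= n < partial_mult m (block m n).+1)%N.
Proof.
rewrite /block; case: xgetP => [i -> //|] H0; exfalso.
have ex : exists i, (n < partial_mult m i.+1)%N.
  by exists n; exact: leq_partial_mult.
have ni := ex_minnP ex; case: ni => i ni imin; apply: (H0 i) => /=; rewrite ni andbT.
case: i ni imin => [|i] ni imin; first by rewrite /partial_mult big_ord0.
by rewrite leqNgt; apply/negP => /imin; rewrite ltnn.
Qed.

Lemma block_eq0 n : (block m n == 0%N) = (n < m 0%N)%N.
Proof.
have /andP[bn nb] := blockP n; apply/eqP/idP => [b0|n0].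
  by rewrite b0 partial_mult1 in nb.
apply/eqP; rewrite -leqn0 leqNgt; apply/negP => /partial_mult_homo b1.
by rewrite partial_mult1 in b1; rewrite ltnNge (leq_trans b1 bn) in n0.
Qed.

(** Turns a bound on the block index into a bound on the entry itself. *)
Lemma ltn_block M n : (forall j, m j <= M)%N -> (n < M * (block m n).+1)%N.
Proof.
move=> mM; have /andP[_ nb] := blockP n; apply: leq_trans nb _.
elim: (block m n).+1 => [|i IH]; first by rewrite /partial_mult big_ord0.
by rewrite partial_multS mulnS addnC leq_add.
Qed.

End Block.

(** * Weighted norms, and lower and upper bounds on minimal errors *)

Section WeightedSpace.
Context {R : realType} {k : scalars}.
Variables (omega : R) (m : nat -> nat) (a b : nat -> R).
Hypotheses (homega : 0 < omega < 1) (m_gt0 : forall j, (0 < m j)%N).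
Hypotheses (a_gt0 : forall j, 0 < a j) (b_gt0 : forall j, 0 < b j).
Variables (H : hilbertSpace R k) (e : nat -> H).
Hypothesis he : orthonormal_basis e.
Variables (s : nat) (V : hilbertSpace R k) (T : ('I_s -> H) -> V).
Hypothesis hT : hilbert_tensor_power T.
Local Notation K := (scalarField R k).
Local Notation wt := (@weight R omega m a b s).
Local Notation E := (tensor_basis e T).
Local Notation wsq := (wnorm_sq omega m a b e T).
Local Notation wsp := (wspace omega m a b e T).
Local Notation wn := (wnorm omega m a b e T).
Let orthoE := tensor_basis_ortho he hT.

Lemma weight_ge1 n : 1 <= wt n.
Proof.
have /andP[om0 om1] := homega; rewrite /weight -[leLHS](powRr0 omega).
apply: ger_powR; first by rewrite om0 ltW.
rewrite oppr_le0; apply: sumr_ge0 => j _.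
by rewrite mulr_ge0 ?powR_ge0// ltW.
Qed.

Lemma weight_eq1 (n : {ffun 'I_s -> nat}) : (forall j, (n j < m 0%N)%N) -> wt n = 1.
Proof.
move=> n0; rewrite /weight big1 ?oppr0 ?powRr0// => j _.
have /eqP -> : block m (n j) == 0%N by rewrite block_eq0.
(* The real power of 0 vanishes only because the exponent [b j] is nonzero. *)
by rewrite powR0 ?mulr0// gt_eqF.
Qed.

Lemma wterm_ge0 f n : 0 <= wt n * norm (hdot f (E n)) ^+ 2.
Proof. by rewrite mulr_ge0 ?sqr_ge0// (le_trans ler01 (weight_ge1 n)). Qed.

(** Membership matters: [wnorm] passes through [fine], which sends an infinite sum to 0. *)
Lemma wspace_sum_le f r : wsp f -> uniq r ->
  \sum_(n <- r) wt n * norm (hdot f (E n)) ^+ 2 <= wn f ^+ 2.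
Proof.
move=> wf ur; have w0 : (0 <= wsq f)%E by apply: esum_ge0 => n _; rewrite lee_fin wterm_ge0.
rewrite /wnorm sqr_sqrtr ?fine_ge0//.
by rewrite -lee_fin fineK ?ge0_fin_numE// esum_ge_seq.
Qed.

Lemma wspace_bound f (B : R) :
  (forall r, uniq r -> \sum_(n <- r) wt n * norm (hdot f (E n)) ^+ 2 <= B) ->
  wsp f /\ wn f ^+ 2 <= B.
Proof.
move=> fB; have wB : (wsq f <= B%:E)%E by exact: esum_le_seq.
have wf : wsp f by exact: le_lt_trans wB (ltry _).
split=> //; have w0 : (0 <= wsq f)%E by apply: esum_ge0 => n _; rewrite lee_fin wterm_ge0.
by rewrite /wnorm sqr_sqrtr ?fine_ge0// -lee_fin fineK ?ge0_fin_numE.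
Qed.

Lemma wspaceP c f g : wsp f -> wsp g -> wsp (c *: f + g).
Proof.
move=> wf wg.
(* The bound comes from (u v + w)^2 <= 2 u^2 v^2 + 2 w^2, whose two sides differ by (u v - w)^2. *)
apply: (wspace_bound (B := 2 * norm c ^+ 2 * wn f ^+ 2 + 2 * wn g ^+ 2) _).1 => r ur.
have := lerD (ler_wpM2l (mulr_ge0 (ler0n R 2) (sqr_ge0 (norm c))) (wspace_sum_le wf ur))
             (ler_wpM2l (ler0n R 2) (wspace_sum_le wg ur)).
apply: le_trans; rewrite !mulr_sumr -big_split /=; apply: ler_sum => n _.
rewrite hdotPl; set x := hdot f _; set y := hdot g _.
have w0 := le_trans ler01 (weight_ge1 n).
have xy : norm (c * x + y) <= norm c * norm x + norm y by rewrite -normM; exact: normD.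
have {xy} : norm (c * x + y) ^+ 2 <= (norm c * norm x + norm y) ^+ 2.
  by rewrite ler_pXn2r// nnegrE ?norm_ge0// addr_ge0 ?mulr_ge0 ?norm_ge0.
move=> /(ler_wpM2l w0) /le_trans; apply.
rewrite -subr_ge0; set u := norm c; set v := norm x; set w := norm y.
rewrite (_ : _ - _ = wt n * (u * v - w) ^+ 2); first by rewrite mulr_ge0 ?sqr_ge0.
by ring.
Qed.

Lemma wspace_basis n : wsp (E n).
Proof.
apply: (wspace_bound (B := wt n) _).1 => r ur.
have term i : wt i * norm (hdot (E n) (E i)) ^+ 2 = if i == n then wt n else 0.
  rewrite orthoE eq_sym; case: eqP => [->|_]; last first.
    by rewrite norm0 expr0n mulr0.
  rewrite [norm _](_ : _ = 1) ?expr1n ?mulr1//.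
  by apply: (@sinj_inj _ k); rewrite sinj_norm normr1 rmorph1.
under eq_bigr do rewrite term.
rewrite -big_mkcond; have [nr|nr] := boolP (n \in r).
  rewrite big_mkcond (bigD1_seq n)//= eqxx big1 ?addr0// => i /negPf ->//.
rewrite big1_seq ?(le_trans ler01 (weight_ge1 n))// => i /andP[/eqP -> ir].
by rewrite ir in nr.
Qed.

Lemma wspace0 : wsp 0.
Proof.
apply: (wspace_bound (B := 0) _).1 => r ur; rewrite big1// => n _.
by rewrite linear0l norm0 expr0n mulr0.
Qed.

Lemma wspace_sum n (c : 'I_n -> K) (i : 'I_n -> {ffun 'I_s -> nat}) :
  wsp (\sum_(j < n) c j *: E (i j)).
Proof.
elim/big_rec: _ => [|j x _ wx]; first exact: wspace0.
exact: wspaceP (wspace_basis _) wx.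
Qed.

Section Functional.
Variables (L : V -> K) (hL : continuous_functional omega m a b e T L).

Lemma functional0 : L 0 = 0.
Proof.
have := functional_linear hL 1 wspace0 wspace0.
by rewrite scaler0 addr0 mul1r => /eqP; rewrite -subr_eq0 opprD addrA subrr add0r oppr_eq0 => /eqP.
Qed.

Lemma functionalZ c f : wsp f -> L (c *: f) = c * L f.
Proof.
by move=> wf; have := functional_linear hL c wf wspace0; rewrite functional0 !addr0.
Qed.

Lemma functional_sum n (c : 'I_n -> K) (i : 'I_n -> {ffun 'I_s -> nat}) :
  L (\sum_(j < n) c j *: E (i j)) = \sum_(j < n) c j * L (E (i j)).
Proof.
(* [L] is linear only on [wspace], so membership of the partial sums is carried through the
   induction. *)
pose P x y := wsp x /\ L x = y.
suff [] : P (\sum_(j < n) c j *: E (i j)) (\sum_(j < n) c j * L (E (i j))) by [].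
apply: (big_rec2 P) => [|j y x _ [wx <-]]; first by split; [exact: wspace0|exact: functional0].
split; first exact: wspaceP (wspace_basis _) wx.
by rewrite (functional_linear hL _ (wspace_basis _) wx).
Qed.

End Functional.

Lemma minimal_error_ge1 n : (n < m 0%N ^ s)%N ->
  (1 <= minimal_error omega m a b e T n)%E.
Proof.
move=> nm; apply: le_ereal_inf_tmp => _ [_ [L [g [hL ->]]] <-].
pose F := {ffun 'I_s -> 'I_(m 0%N)}.
pose ix (i : 'I_#|F|) : {ffun 'I_s -> nat} := [ffun j => val (enum_val i j)].
have ix_inj : injective ix.
  move=> i j /ffunP ij; apply: enum_val_inj; apply/ffunP => l; apply/val_inj.
  by have := ij l; rewrite !ffunE.
(* Rows are the weight-one basis tensors, columns the functionals: with more rows than columns, a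
   left kernel vector gives a combination on which every [L j] vanishes. *)
pose M := \matrix_(i < #|F|, j < n) L j (E (ix i)).
have : kermx M != 0.
  rewrite kermx_eq0 /row_free neq_ltn (leq_ltn_trans (rank_leq_col M))//.
  by rewrite card_ffun !card_ord.
move=> /rowV0Pn[c /sub_kermxP cM c0].
pose f := \sum_(i < #|F|) c 0 i *: E (ix i).
have fE i : hdot f (E (ix i)) = c 0 i.
  rewrite /f hdot_sumZl (bigD1 i)//= orthoE eqxx mulr1 big1 ?addr0// => j ji.
  by rewrite orthoE (inj_eq ix_inj) (negPf ji) mulr0.
have f0 : f != 0.
  apply: contraNneq c0 => f0; apply/eqP/rowP => i.
  by rewrite -fE f0 linear0l mxE.
have Lf j : L j f = 0.
  rewrite (functional_sum (hL j)); have /rowP/(_ j) := cM; rewrite !mxE => cMj.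
  by rewrite -[RHS]cMj; apply: eq_bigr => i _; rewrite mxE.
have wf : wsp f by exact: wspace_sum.
pose f' := sinj k (norm f)^-1 *: f.
have nf' : norm f' = 1.
  rewrite normZ (_ : norm _ = (norm f)^-1) ?mulVf ?norm_eq0//.
  apply: (@sinj_inj _ k); rewrite sinj_norm ger0_norm//.
  by rewrite -(rmorph0 (sinj k)) ler_sinj invr_ge0 norm_ge0.
(* Coefficients of [f'] vanish wherever the weight may exceed 1, so its weighted norm is bounded by
   its Hilbert norm through Bessel. *)
have [wf' wnf'] : wsp f' /\ wn f' ^+ 2 <= 1.
  apply: wspace_bound => r ur; apply: le_trans (_ : _ <= norm f' ^+ 2) _; last first.
    by rewrite nf' expr1n.
  apply: le_trans (bessel orthoE f' ur); apply: ler_sum => i _.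
  have [/forallP im|/forallPn[j ij]] := boolP [forall j, (i j < m 0%N)%N].
    by rewrite weight_eq1// mul1r.
  suff -> : hdot f' (E i) = 0 by rewrite norm0 expr0n mulr0.
  rewrite linearZl_LR /= [hdot f _](_ : _ = 0) ?mulr0// hdot_sumZl big1// => l _.
  rewrite orthoE; case: eqP => [il|_]; last by rewrite mulr0.
  by move: ij; rewrite -il ffunE ltn_ord.
apply: ereal_sup_ubound; exists f'.
  split=> //; rewrite -(@ler_pXn2r _ 2) ?nnegrE ?sqrtr_ge0//.
  by rewrite expr1n.
by rewrite big1 ?subr0 ?nf'// => j _; rewrite (functionalZ (hL j))// Lf mulr0 scale0r.
Qed.

(** All weights are at least 1, so a coefficient is bounded by the weighted norm and [delta = eps]
    works. *)
Lemma hdot_basis_continuous n :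
  continuous_functional omega m a b e T (fun f => hdot f (E n)).
Proof.
split=> [c f g _ _|f wf eps eps0]; first exact: hdotPl.
exists eps => // g wg; apply: le_lt_trans.
have wgf : wsp (g - f) by rewrite addrC -scaleN1r; exact: wspaceP.
rewrite -linearBl /= -(@ler_pXn2r _ 2) ?nnegrE ?norm_ge0 ?sqrtr_ge0//.
apply: le_trans (wspace_sum_le wgf (isT : uniq [:: n])); rewrite big_seq1.
by rewrite ler_peMl ?sqr_ge0// weight_ge1.
Qed.

(** The projection onto the tensors of [S] realises the bound: off [S], a squared coefficient is at
    most [eps ^+ 2] times its weighted version, and Parseval sums these up. *)
Lemma minimal_error_le S (eps : R) : uniq S -> 0 < eps ->
  (forall n, n \notin S -> eps ^- 2 <= wt n) ->
  (minimal_error omega m a b e T (size S) <= eps%:E)%E.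
Proof.
move=> uS eps0 Sw; pose n0 : {ffun 'I_s -> nat} := [ffun=> 0%N].
pose A f := \sum_(j < size S) hdot f (E (nth n0 S j)) *: E (nth n0 S j).
apply: le_trans (_ : _ <= worst_case_error omega m a b e T A)%E _.
  apply: ereal_inf_lbound; exists A => //.
  exists (fun j f => hdot f (E (nth n0 S j))), (fun j => E (nth n0 S j)); split=> // j.
  exact: hdot_basis_continuous.
apply: ge_ereal_sup => _ [f /= [wf nf] <-]; rewrite lee_fin.
have -> : A f = oproj E S f by rewrite /A /oproj (big_nth n0) big_mkord.
rewrite -(@ler_pXn2r _ 2) ?nnegrE ?norm_ge0 ?(ltW eps0)//.
apply: (parseval_le orthoE (tensor_basis_total he hT)) => r ur.
apply: le_trans (_ : _ <= eps ^+ 2 * wn f ^+ 2) _; last first.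
  by rewrite ler_piMr ?sqr_ge0// expr_le1// sqrtr_ge0.
apply: le_trans (ler_wpM2l (sqr_ge0 eps) (wspace_sum_le wf ur)); rewrite mulr_sumr.
apply: ler_sum => n _; rewrite linearBl /= /oproj hdot_sum_orthonormal//.
case: ifPn => nS; first by rewrite subrr norm0 expr0n mulr_ge0 ?sqr_ge0 ?wterm_ge0.
rewrite subr0 mulrA ler_peMl ?sqr_ge0//.
by rewrite mulrC -ler_pdivrMr ?exprn_gt0// div1r Sw.
Qed.

End WeightedSpace.

(** * Information complexity *)

(* A code is a family with values below [m0] and a list of [K] corrections
   (position, value); short lists are padded with the value at position 0. *)
Lemma sparse_family_count (s m0 Q K : nat) : (0 < s)%N -> (0 < m0)%N ->
  exists S : seq {ffun 'I_s -> nat}, [/\ uniq S, (size S <= m0 ^ s * (s * Q) ^ K)%N &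
    forall n : {ffun 'I_s -> nat}, (forall j, n j < Q)%N ->
      (#|[pred j | (m0 <= n j)%N]| <= K)%N -> n \in S].
Proof.
move=> s0 m00; pose P := ({ffun 'I_s -> 'I_m0} * K.-tuple ('I_s * 'I_Q))%type.
pose g (p : P) := [ffun j => head (val (p.1 j)) [seq val q.2 | q <- p.2 & q.1 == j]].
exists (undup [seq g p | p <- enum {: P}]); split; first exact: undup_uniq.
  rewrite (leq_trans (size_undup _))// size_map -cardE card_prod card_ffun.
  by rewrite card_tuple card_prod !card_ord.
move=> n nQ nK; rewrite mem_undup; set D := [pred j | _] in nK.
pose l := [seq (j, Ordinal (nQ j)) | j <- enum D ++ nseq (K - #|D|) (Ordinal s0)].
have sl : size l == K by rewrite size_map size_cat size_nseq -cardE subnKC.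
(* Entries of at least [m0] fall back to 0 in [f]; the corrections in [l] override them. *)
pose f : {ffun 'I_s -> 'I_m0} := [ffun j => insubd (Ordinal m00) (n j)].
apply/mapP; exists (f, Tuple sl); first by rewrite mem_enum.
apply/ffunP => j; rewrite !ffunE /=.
(* All corrections at [j], padding included, carry the value [n j], so taking the first one is
   safe. *)
set r := [seq q <- l | q.1 == j].
have nr q : q \in r -> val q.2 = n j.
  by rewrite mem_filter => /andP[/eqP <- /mapP[i _ ->]].
have [jD|jD] := boolP (j \in D).
  have : (j, Ordinal (nQ j)) \in r.
    by rewrite mem_filter eqxx map_f// mem_cat mem_enum jD.
  by case: r nr => [//|q r] /(_ q (mem_head q r)) /= ->.
case: r nr => [_|q r /(_ q (mem_head q r)) <- //] /=.
by move: jD; rewrite inE /= -ltnNge val_insubd => ->.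
Qed.

Section Complexity.
Context {R : realType} {k : scalars}.
Variables (omega : R) (m : nat -> nat) (a b : nat -> R) (M : nat).
Hypotheses (homega : 0 < omega < 1) (m_gt0 : forall j, (0 < m j)%N).
Hypothesis m_le : forall j, (m j <= M)%N.
Hypotheses (a_gt0 : forall j, 0 < a j) (b_gt0 : forall j, 0 < b j).
Hypothesis a_nondecreasing : forall i j, (i <= j)%N -> a i <= a j.
Variable beta : R.
Hypotheses (beta_gt0 : 0 < beta) (beta_le : forall j, beta <= b j).
Variables (H : hilbertSpace R k) (e : nat -> H).
Hypothesis he : orthonormal_basis e.
Variables (s : nat) (V : hilbertSpace R k) (T : ('I_s -> H) -> V).
Hypotheses (hT : hilbert_tensor_power T) (s_gt0 : (0 < s)%N).
Local Notation info := (info_complexity omega m a b e T).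

Lemma info_ge eps : eps < 1 -> ((m 0%N ^ s)%:R%:E <= info eps)%E.
Proof.
move=> eps1; apply: le_ereal_inf_tmp => _ [n /= ne <-]; rewrite lee_fin ler_nat.
rewrite leqNgt; apply/negP => nm.
have := le_trans (minimal_error_ge1 homega m_gt0 a_gt0 b_gt0 he hT nm) ne.
by rewrite lee_fin leNgt eps1.
Qed.

(** Taking logarithms in [weight < eps ^- 2] bounds the sum in the exponent by 2 ln (1/eps) / (- ln
    omega); dividing by [a 0], the least [a j], gives this factor. *)
Let c := 2 / (- ln omega * a 0%N).

Let ln_omega_gt0 : 0 < - ln omega.
Proof. by rewrite oppr_gt0 ln_lt0. Qed.

Let c_gt0 : 0 < c.
Proof. by rewrite divr_gt0// mulr_gt0. Qed.

Lemma weight_lt_sum (n : {ffun 'I_s -> nat}) eps : 0 < eps < 1 ->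
  weight omega m a b n < eps ^- 2 ->
  \sum_(j < s) (block m (n j))%:R `^ b j < c * ln eps^-1.
Proof.
move=> /andP[eps0 eps1]; have /andP[om0 om1] := homega.
rewrite -ltr_ln ?posrE ?powR_gt0 ?invr_gt0 ?exprn_gt0// /weight ln_powR.
rewrite -exprVn lnXn ?invr_gt0// mulNr -mulrN => Sln.
have a0S : a 0%N * \sum_(j < s) (block m (n j))%:R `^ b j <=
    \sum_(j < s) a j * (block m (n j))%:R `^ b j.
  by rewrite mulr_sumr; apply: ler_sum => j _; rewrite ler_wpM2r ?powR_ge0// a_nondecreasing.
have := le_lt_trans (ler_wpM2r (ltW ln_omega_gt0) a0S) Sln.
rewrite -mulr_natl /c => h; rewrite mulrAC ltr_pdivlMr ?mulr_gt0//.
by rewrite mulrA mulrAC [_ * a 0%N]mulrC.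
Qed.

Lemma ln_info_le eps : 0 < eps < 1 ->
  exists N : R, [/\ 1 <= N, info eps = N%:E &
    ln N <= s%:R * ln (m 0%N)%:R +
      c * ln eps^-1 * (ln s%:R + ln M%:R + 1 + c * ln eps^-1 / beta)].
Proof.
move=> /[dup] epsI /andP[eps0 eps1]; set x := c * ln eps^-1.
have x0 : 0 < x by rewrite mulr_gt0// ln_gt0// invf_gt1.
(* Each entry outside the first block adds at least 1 to a sum below [x], hence [K]; its block index
   i satisfies i^beta <= x, hence [Q]. *)
pose K := Num.truncn x; pose Q := (M * (Num.truncn (x `^ beta^-1)).+1)%N.
have M0 : (0 < M)%N := leq_trans (m_gt0 0) (m_le 0).
have Q0 : (0 < Q)%N by rewrite muln_gt0 M0.
have [S [uS sS inS]] := sparse_family_count Q K s_gt0 (m_gt0 0).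
have infoS : (info eps <= (size S)%:R%:E)%E.
  apply: ereal_inf_lbound; exists (size S) => //=.
  apply: (minimal_error_le homega a_gt0 he hT uS eps0) => n nS.
  rewrite leNgt; apply/negP => /(weight_lt_sum epsI); rewrite -/x => nx.
  have kx j : (block m (n j))%:R `^ b j <= x.
    apply: le_trans (ltW nx); rewrite (bigD1 j)//= lerDl.
    by apply: sumr_ge0 => i _; exact: powR_ge0.
  move/negP: nS; apply; apply: inS => [j|].
    apply: leq_trans (ltn_block m_gt0 (n j) m_le) _; rewrite leq_mul2l ltnS.
    (* Block 0 is treated apart because monotonicity of a power in its exponent requires a base of
       at least 1. *)
    apply/orP; right; have [->//|b1] := posnP (block m (n j)).
    rewrite truncn_ge_nat ?powR_ge0//.
    rewrite -[leLHS]powRr1// -[X in _ `^ X <= _](mulfV (lt0r_neq0 beta_gt0)) powRrM.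
    rewrite ge0_ler_powR ?nnegrE ?invr_ge0 ?powR_ge0 ?(ltW beta_gt0) ?(ltW x0)//.
    by apply: le_trans (kx j); rewrite ler_powR ?ler1n.
  rewrite truncn_ge_nat ?(ltW x0)//; apply: le_trans (ltW nx).
  rewrite -sum1_card natr_sum big_mkcond; apply: ler_sum => j _; rewrite inE.
  case: ifPn => [mn|_]; last exact: powR_ge0.
  have b1 : (0 < block m (n j))%N by rewrite lt0n block_eq0// -leqNgt.
  have : 1 `^ b j <= (block m (n j))%:R `^ b j by rewrite ge0_ler_powR ?nnegrE ?ler1n// ltW.
  by rewrite powR1.
have info1 : (1 <= info eps)%E.
  apply: le_trans (info_ge eps1); rewrite lee_fin ler1n expn_gt0 m_gt0//.
have [N NE] : exists N, info eps = N%:E.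
  by move: infoS info1; case: (info eps) => [N| |] // _ _; exists N.
exists N; rewrite NE !lee_fin in infoS info1 *; split=> //.
have S0 : 0 < (size S)%:R :> R by exact: lt_le_trans ltr01 (le_trans info1 infoS).
have le_ln (y z : R) : 0 < y -> y <= z -> ln y <= ln z.
  by move=> y0 yz; rewrite ler_ln ?posrE// (lt_le_trans y0).
apply: le_trans (le_ln _ _ (lt_le_trans ltr01 info1) infoS) _.
apply: le_trans (le_ln _ (m 0%N ^ s * (s * Q) ^ K)%:R S0 _) _; first by rewrite ler_nat.
rewrite natrM !natrX lnM ?posrE ?exprn_gt0 ?ltr0n ?muln_gt0 ?s_gt0 ?m_gt0 ?M0//.
rewrite !lnXn ?ltr0n ?muln_gt0 ?s_gt0 ?m_gt0 ?M0// mulr_natl lerD2l.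
rewrite -[leLHS]mulr_natl; apply: ler_pM => //.
- by rewrite ln_ge0// ler1n muln_gt0 s_gt0 Q0.
- by rewrite truncn_le ltW.
rewrite natrM lnM ?posrE ?ltr0n// -!addrA lerD2l.
rewrite natrM lnM ?posrE ?ltr0n// lerD2l.
(* The factor of [Q] besides [M] is at most 2 (1 + x)^(1/beta); then ln 2 <= 1 and ln (1 + x) <= x
   give the term [1 + x / beta]. *)
apply: le_trans (le_ln _ (2 * (1 + x) `^ beta^-1) _ _) _; first by rewrite ltr0n.
  have mono (y : R) : 0 <= y -> y <= 1 + x -> y `^ beta^-1 <= (1 + x) `^ beta^-1.
    move=> y0 yx; rewrite ge0_ler_powR ?nnegrE ?invr_ge0 ?(ltW beta_gt0)//.
    exact: le_trans yx.
  have := mono 1 ler01; rewrite powR1 lerDl (ltW x0) => /(_ isT) one_le.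
  rewrite -natr1 mulr_natl mulr2n lerD//.
  apply: le_trans (mono x (ltW x0) _); last by rewrite lerDr.
  by rewrite truncn_le powR_ge0.
rewrite lnM ?posrE ?powR_gt0 ?addr_gt0// ln_powR lerD//.
  by rewrite -[2](_ : 1 + 1 = 2)// le_ln1Dx// lerNl (le_trans _ ler01)// oppr_le0.
by rewrite mulrC ler_wpM2r ?invr_ge0 ?(ltW beta_gt0)// le_ln1Dx// (lt_trans _ x0)// oppr_lt0.
Qed.

End Complexity.

(** * Growth of logarithms *)

Section Asymptotics.
Context {R : realType}.
Implicit Types D p : R.

(** ln D = 4 ln D^(1/4) <= 4 D^(1/4) and 1 <= D^(1/4), so 1 + ln D <= 5 D^(1/4), which is
    squared. *)
Lemma sqr_ln_le_sqrt D : 1 <= D -> (1 + ln D) ^+ 2 <= 25 * D `^ 2^-1.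
Proof.
move=> D1; have D0 : 0 < D by exact: lt_le_trans D1.
have r1 : 1 <= D `^ 4^-1.
  have q0 : 0 <= 4^-1 :> R by rewrite invr_ge0.
  by have := ler_powR D1 q0; rewrite powRr0.
have lnD : ln D <= 4 * D `^ 4^-1.
  rewrite -[ln D](mulVKf (_ : 4 != 0 :> R)) ?pnatr_eq0// -ln_powR.
  by rewrite ler_wpM2l// ltW// ln_sublinear// powR_gt0.
have -> : 25 * D `^ 2^-1 = (5 * D `^ 4^-1) ^+ 2.
  rewrite exprMn -[D `^ 4^-1 ^+ 2]powR_mulrn ?powR_ge0// -powRrM.
  by congr (_ * D `^ _); [rewrite -natrX|field].
rewrite ler_pXn2r ?nnegrE ?addr_ge0 ?ln_ge0 ?mulr_ge0 ?powR_ge0//.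
by apply: le_trans (lerD r1 lnD) _; lra.
Qed.

Lemma sublinear_powR C p delta : p < 1 -> 0 < delta ->
  exists D0 : R, forall D, D0 < D -> 1 <= D -> C * D `^ p < delta * D.
Proof.
(* Beyond this threshold D^(1 - p) exceeds |C| / delta. *)
move=> p1 delta0; exists ((`|C| / delta) `^ (1 - p)^-1) => D DD D1.
have D0 : 0 < D by exact: lt_le_trans D1.
have p0 : 0 < 1 - p by rewrite subr_gt0.
have h : `|C| / delta < D `^ (1 - p).
  have -> : `|C| / delta = ((`|C| / delta) `^ (1 - p)^-1) `^ (1 - p).
    by rewrite -powRrM mulVf ?gt_eqF// powRr1// divr_ge0// ltW.
  by rewrite gt0_ltr_powR// nnegrE ?powR_ge0// ltW.
rewrite ltr_pdivrMr// in h.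
have DE : D = D `^ (1 - p) * D `^ p.
  by rewrite -powRD ?subrK ?powRr1 ?(ltW D0)// (gt_eqF D0) implybT.
rewrite [in ltRHS]DE mulrA [delta * _]mulrC ltr_pM2r ?powR_gt0//.
exact: le_lt_trans (ler_norm C) h.
Qed.

(** Converts the limit in s + 1/eps into one in the denominator: if the sum is at least 2 B, one
    summand is at least [B], which exceeds both the t1-th and the t2-th root of |D0|. *)
Lemma powR_sum_cofinal (t1 t2 D0 : R) : 0 < t1 -> 0 < t2 ->
  exists M : R, forall x y : R, 0 <= x -> 0 <= y -> M <= x + y ->
    D0 < x `^ t1 + y `^ t2.
Proof.
move=> t10 t20; pose B := 1 + `|D0| `^ t1^-1 + `|D0| `^ t2^-1.
exists (B + B) => x y x0 y0 Bxy.
have large t z : 0 < t -> `|D0| `^ t^-1 < z -> D0 < z `^ t.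
  move=> t0 Dz; apply: le_lt_trans (ler_norm D0) _.
  have -> : `|D0| = (`|D0| `^ t^-1) `^ t by rewrite -powRrM mulVf ?gt_eqF// powRr1.
  by rewrite gt0_ltr_powR// nnegrE ?powR_ge0// (le_trans _ (ltW Dz))// powR_ge0.
have B1 : `|D0| `^ t1^-1 < B by rewrite /B addrAC ltr_pwDl// ltr_pwDl// powR_ge0.
have B2 : `|D0| `^ t2^-1 < B by rewrite /B ltr_pwDl// ltr_pwDl// powR_ge0.
have [Bx|xB] := leP B x.
  by rewrite ltr_wpDr ?powR_ge0// large// (lt_le_trans B1).
rewrite ltr_wpDl ?powR_ge0// large// (lt_le_trans B2)//.
by rewrite -(lerD2l x) (le_trans _ Bxy)// lerD2r ltW.
Qed.

End Asymptotics.

(** * Weak tractability *)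

Section Tractability.
Context {R : realType} {k : scalars} {H : hilbertSpace R k} {e : nat -> H}.
Hypothesis he : orthonormal_basis e.
Context {Hs : nat -> hilbertSpace R k} {T : forall s : nat, ('I_s -> H) -> Hs s}.
Hypothesis hT : forall s : nat, (0 < s)%N -> hilbert_tensor_power (@T s).
Variables (omega : R) (m : nat -> nat) (a b : nat -> R) (t1 t2 : R).
Hypotheses (homega : 0 < omega < 1) (m_gt0 : forall j, (0 < m j)%N).
Hypotheses (a_gt0 : forall j, 0 < a j) (b_gt0 : forall j, 0 < b j).
Hypotheses (ht1 : 0 < t1) (ht2 : 0 < t2).
Local Notation info := (fun s eps => info_complexity omega m a b e (@T s) eps).

(** If t1 <= 1 and m 0 >= 2, then for eps = 1/2 and large [s] the logarithm is at least s ln 2 while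
    the denominator is at most 2 s, so the quotient is at least ln 2 / 2. *)
Lemma tractable_necessary : weakly_tractable t1 t2 info -> 1 < t1 \/ m 0%N = 1%N.
Proof.
move=> wt; have [t11|t11] := ltP 1 t1; [by left|right].
apply/eqP; rewrite eqn_leq m_gt0 andbT leqNgt; apply/negP => m1.
have ln2 : 0 < ln 2 :> R by rewrite ln_gt0// ltr1n.
have [|M MP] := wt (ln 2 / 2); first by rewrite divr_gt0.
(* [s] passes the threshold [M] and dominates 2^t2, the value of eps^(-t2) at eps = 1/2. *)
pose s := maxn 1 (Num.truncn (Num.max M (2 `^ t2))).+1.
have s0 : (0 < s)%N by rewrite leq_max.
have s1 : 1 <= s%:R :> R by rewrite ler1n.
have large x : x <= Num.max M (2 `^ t2) -> x <= s%:R.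
  move=> /le_trans; apply; apply: le_trans (ltW (truncnS_gt _)) _.
  by rewrite ler_nat leq_maxr.
have half : 0 < (2^-1 : R) < 1 by rewrite invr_gt0 ltr0n/= invf_lt1// ltr1n.
have /andP[_ half1] := half.
have Ms : M <= s%:R + 2^-1^-1.
  by rewrite (le_trans (large _ _))// ?le_max ?lexx// lerDl invrK.
have := MP s _ s0 half Ms; have infoge := info_ge homega m_gt0 a_gt0 b_gt0 he (hT s0) half1.
set D := _ + _; have D0 : 0 < D by rewrite ltr_pwDl ?powR_gt0// (lt_le_trans _ s1).
have info1 : (1 <= info s (2^-1)%R)%E.
  by apply: le_trans infoge; rewrite lee_fin ler1n expn_gt0 m_gt0.
have : ((s%:R * ln 2)%:E <= lne (info s (2^-1)%R))%E.
  rewrite mulr_natl -lnXn// -lne_EFin ?exprn_gt0// lee_lne.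
  - by apply: le_trans infoge; rewrite -natrX lee_fin ler_nat leq_exp2r.
  - by rewrite in_itv/= leey lee_fin exprn_ge0.
  - by rewrite in_itv/= leey (le_trans _ info1).
move=> lneN; rewrite gee0_abs; last first.
  by rewrite mule_ge0 ?lne_ge0// lee_fin invr_ge0 ltW.
apply/negP; rewrite -leNgt; apply: le_trans (lee_wpmul2r _ lneN); last first.
  by rewrite lee_fin invr_ge0 ltW.
rewrite -EFinM lee_fin ler_pdivlMr//.
have Ds : D <= s%:R + s%:R.
  rewrite lerD//; first by rewrite (le_trans (ler_powR s1 t11))// powRr1.
  by rewrite -[2^-1]powR_inv1// -powRrM mulrNN mul1r large// le_max lexx orbT.
by nra.
Qed.

(** One exponent [p] below 1 serves both terms of the bound: at least 1/t1 for the first block when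
    t1 > 1, and at least 1/2 for the squared logarithm. If m 0 = 1, the first-block term is zero. *)
Lemma first_block_term_le : 1 < t1 \/ m 0%N = 1%N -> exists2 p, 2^-1 <= p < 1 &
  forall x D : R, 0 <= x -> 1 <= D -> x `^ t1 <= D ->
    x * ln (m 0%N)%:R <= ln (m 0%N)%:R * D `^ p.
Proof.
move=> [t11|->]; last first.
  exists 2^-1 => [|x D _ _ _]; last by rewrite ln1 mulr0 mul0r.
  by rewrite lexx invf_lt1// ltr1n.
exists (Num.max 2^-1 t1^-1) => [|x D x0 D1 xD].
  by rewrite le_max lexx gt_max !invf_lt1// ltr1n.
rewrite mulrC ler_wpM2l ?ln_ge0 ?ler1n//.
apply: le_trans (_ : _ <= D `^ t1^-1) _; last by rewrite ler_powR// le_max lexx orbT.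
have -> : x = (x `^ t1) `^ t1^-1 by rewrite -powRrM mulfV ?gt_eqF// powRr1.
by rewrite ge0_ler_powR ?nnegrE ?powR_ge0 ?invr_ge0 ?(ltW ht1) ?(le_trans ler01 D1).
Qed.

Hypothesis m_bounded : exists M : nat, forall j, (m j <= M)%N.
Hypothesis a_nondecreasing : forall i j, (i <= j)%N -> a i <= a j.
Hypothesis b_inf : 0 < inf (range b).

Lemma tractable_sufficient : 1 < t1 \/ m 0%N = 1%N -> weakly_tractable t1 t2 info.
Proof.
move=> /first_block_term_le[p /andP[p_ge p_lt] m0_le] delta delta0.
have [M mM] := m_bounded; set beta := inf (range b).
have beta0 : 0 < beta by [].
(* The range of [b] is bounded below by 0, so its [inf] is a genuine lower bound. *)
have beta_le j : beta <= b j.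
  by apply: ge_inf; [exists 0 => _ [i _ <-]; exact: ltW|exists j].
set L := ln (m 0%N)%:R in m0_le *.
pose c := 2 / (- ln omega * a 0%N).
have c0 : 0 < c by rewrite divr_gt0// mulr_gt0// oppr_gt0 ln_lt0.
have M0 : 0 <= ln M%:R :> R by rewrite ln_ge0// ler1n (leq_trans (m_gt0 0) (mM 0)).
(* With l = ln D, [P] is chosen so that c ln (1/eps) <= P (1 + l), and [C] so that the second term
   of [ln_info_le] is at most C (1 + l)^2. *)
pose P := c / t2; have P0 : 0 < P by rewrite divr_gt0.
pose C := P * (t1^-1 + ln M%:R + 1 + P / beta).
have C0 : 0 <= C.
  have tV : 0 <= t1^-1 by rewrite invr_ge0 ltW.
  have PV : 0 <= P / beta by rewrite divr_ge0 ?ltW.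
  by rewrite mulr_ge0 ?(ltW P0)// addr_ge0// addr_ge0// addr_ge0.
(* [L] comes from the first-block term, 25 from [sqr_ln_le_sqrt]. *)
have [D0 D0P] := sublinear_powR (L + C * 25) p_lt delta0.
have [B BP] := powR_sum_cofinal D0 ht1 ht2.
exists B => s eps s0 epsI Bs; have /andP[eps0 eps1] := epsI.
have y1 : 1 < eps^-1 by rewrite invf_gt1.
have s1 : 1 <= s%:R :> R by rewrite ler1n.
have yE : eps `^ (- t2) = eps^-1 `^ t2.
  by rewrite -(powR_inv1 (ltW eps0)) -powRrM mulN1r.
have := BP s%:R eps^-1 (ler0n _ _) (ltW (lt_trans ltr01 y1)) Bs.
rewrite yE; set D := _ + _ => DD.
have sD : s%:R `^ t1 <= D by rewrite lerDl powR_ge0.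
have yD : eps^-1 `^ t2 <= D by rewrite lerDr powR_ge0.
have D1 : 1 <= D.
  by apply: le_trans sD; have := ler_powR s1 (ltW ht1); rewrite powRr0.
have Dgt0 : 0 < D by exact: lt_le_trans D1.
have [N [N1 -> lnN]] := ln_info_le homega m_gt0 mM a_gt0 b_gt0 a_nondecreasing
  beta0 beta_le he (hT s0) s0 epsI.
have lnN0 : 0 <= ln N by rewrite ln_ge0.
rewrite lne_EFin ?(lt_le_trans ltr01)// -EFinM abse_EFin lte_fin.
rewrite ger0_norm ?divr_ge0 ?(ltW Dgt0)// ltr_pdivrMr//.
apply: le_lt_trans (D0P D DD D1); apply: le_trans lnN _.
rewrite [leRHS]mulrDl lerD ?m0_le//.
have Dp : (1 + ln D) ^+ 2 <= 25 * D `^ p.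
  by apply: le_trans (sqr_ln_le_sqrt D1) _; rewrite ler_wpM2l// ler_powR.
rewrite -[leRHS]mulrA; apply: le_trans (ler_wpM2l C0 Dp); rewrite -/c.
have lnD0 := ln_ge0 D1; set l := ln D in lnD0 Dp *.
(* Both s^t1 and eps^(-t2) are at most D, so ln s <= l / t1 and ln (1/eps) <= l / t2. *)
have ln_le (x t : R) : 0 < x -> 0 < t -> x `^ t <= D -> ln x <= l / t.
  by move=> x0 t0 xD; rewrite ler_pdivlMr// mulrC -ln_powR ler_ln ?posrE ?powR_gt0.
have ul : c * ln eps^-1 <= P * (1 + l).
  rewrite /P -mulrA ler_wpM2l ?(ltW c0)//.
  apply: le_trans (ln_le _ _ (lt_trans ltr01 y1) ht2 yD) _.
  by rewrite mulrC ler_wpM2l ?invr_ge0 ?(ltW ht2)// lerDr.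
have sl : ln s%:R <= t1^-1 * (1 + l).
  apply: le_trans (ln_le _ _ (lt_le_trans ltr01 s1) ht1 sD) _.
  by rewrite mulrC ler_wpM2l ?invr_ge0 ?(ltW ht1)// lerDr.
have u0 : 0 <= c * ln eps^-1 by rewrite mulr_ge0 ?(ltW c0)// ln_ge0// ltW.
rewrite (_ : C * _ = (P * (1 + l)) *
    ((t1^-1 + ln M%:R + 1 + P / beta) * (1 + l))); last by rewrite /C; ring.
rewrite ler_pM//.
  have uV : 0 <= c * ln eps^-1 / beta by rewrite divr_ge0 ?(ltW beta0).
  by rewrite addr_ge0// addr_ge0// addr_ge0// ln_ge0.
rewrite [leRHS]mulrDl lerD//; last by rewrite [leRHS]mulrAC ler_wpM2r ?invr_ge0 ?(ltW beta0).
rewrite [leRHS]mulrDl lerD//; last by rewrite mul1r lerDl.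
by rewrite [leRHS]mulrDl lerD// ler_peMr// lerDl.
Qed.

End Tractability.

Theorem theorem2 (R : realType) (k : scalars)
    (H : hilbertSpace R k) (e : nat -> H) (he : orthonormal_basis e)
    (Hs : nat -> hilbertSpace R k) (T : forall s : nat, ('I_s -> H) -> Hs s)
    (hT : forall s : nat, (0 < s)%N -> hilbert_tensor_power (T s))
    (omega : R) (homega : 0 < omega < 1)
    (m : nat -> nat) (m_gt0 : forall j, (0 < m j)%N)
    (m_bounded : exists M : nat, forall j, (m j <= M)%N)
    (a b : nat -> R)
    (a_gt0 : forall j, 0 < a j)
    (a_nondecreasing : forall i j, (i <= j)%N -> a i <= a j)
    (b_gt0 : forall j, 0 < b j)
    (b_inf : 0 < inf (range b))
    (t1 t2 : R) (ht1 : 0 < t1) (ht2 : 0 < t2) :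
  weakly_tractable t1 t2
    (fun s eps => info_complexity omega m a b e (T s) eps)
  <-> (1 < t1 \/ m 0%N = 1%N).
Proof.
split.
  exact: (tractable_necessary he hT homega m_gt0 a_gt0 b_gt0).
exact: (tractable_sufficient he hT homega m_gt0 a_gt0 b_gt0 ht1 ht2 m_bounded
  a_nondecreasing b_inf).
Qed.
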